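(* The core quandle of a group is a Dehn quandle of some group. That is, for every group $G$ there exist a group $H$ and a non-empty subset $A\subseteq H$ such that $\operatorname{Core}(G)\cong\mathcal{D}(A^H)$ as quandles.
   Context: For a group $G$, the core quandle $\operatorname{Core}(G)$ is the set $G$ with the operation $x*y=yx^{-1}y$. For a group $H$ and a non-empty subset $A\subseteq H$, let $A^H$ be the set of all conjugates in $H$ of elements of $A$. The Dehn quandle $\mathcal{D}(A^H)$ is the set $A^H$ with the operation $x*y=yxy^{-1}$. *)

(* Defs.v *)
From HB Require Import structures.
From mathcomp Require Import all_boot all_fingroup.
From mathcomp Require Import boolp classical_sets.

Set Implicit Arguments.
Unset Strict Implicit.
Unset Printing Implicit Defensive.

Local Open Scope classical_set_scope.
Local Open Scope group_scope.

(* Right quandles: the right translations [qop^~ y] are automorphisms. *)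
HB.mixin Record isQuandle (Q : Type) := {
  qop : Q -> Q -> Q ;
  qop_idem : forall x, qop x x = x ;
  qop_bij : forall y, bijective (qop ^~ y) ;
  qop_distr : forall x y z, qop (qop x y) z = qop (qop x z) (qop y z)
}.

#[short(type="quandleType")]
HB.structure Definition Quandle := { Q of isQuandle Q }.

Definition quandle_isomorphic (Q R : quandleType) : Prop :=
  exists f : Q -> R, bijective f /\ {morph f : x y / qop x y >-> qop x y}.

Definition core_quandle (G : groupType) : Type := G.

Section CoreQuandle.
Variable G : groupType.

Definition core_op (x y : G) : G := y * x^-1 * y.

Lemma core_op_idem x : core_op x x = x.
Proof. by rewrite /core_op mulgV mul1g. Qed.

Lemma core_opK y : involutive (core_op ^~ y).
Proof. by move=> x; rewrite /core_op !invgM invgK !mulgA mulgV mul1g mulgKV. Qed.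

Lemma core_op_bij y : bijective (core_op ^~ y).
Proof. exact: inv_bij (@core_opK y). Qed.

Lemma core_op_distr x y z :
  core_op (core_op x y) z = core_op (core_op x z) (core_op y z).
Proof. by rewrite /core_op !invgM !invgK !mulgA !(mulgKV, mulgK). Qed.

HB.instance Definition _ := isQuandle.Build (core_quandle G)
  core_op_idem core_op_bij core_op_distr.

End CoreQuandle.

(* Here [a ^ h] is [h^-1 * a * h]. *)
Definition conj_closure (H : groupType) (A : set H) : set H :=
  [set x | exists2 a, A a & exists h : H, x = a ^ h].

Definition dehn_quandle (H : groupType) (A : set H) : Type := conj_closure A.

Section DehnQuandle.
Variables (H : groupType) (A : set H).

Lemma conj_closureJ x h : x \in conj_closure A -> h * x * h^-1 \in conj_closure A.
Proof.
move=> /set_mem [a Aa [k ->]]; apply: mem_set; exists a => //; exists (k * h^-1).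
by rewrite conjgM [RHS]conjgE invgK -mulgA.
Qed.

Definition dehn_op (x y : conj_closure A) : conj_closure A :=
  exist _ (val y * val x * (val y)^-1) (conj_closureJ (val y) (valP x)).

Lemma dehn_op_idem x : dehn_op x x = x.
Proof. by apply: val_inj; rewrite /= mulgK. Qed.

Lemma dehn_op_bij y : bijective (dehn_op ^~ y).
Proof.
exists (fun x => exist _ ((val y)^-1 * val x * (val y)^-1^-1)
  (conj_closureJ (val y)^-1 (valP x))) => x; apply: val_inj => /=.
  by rewrite invgK !mulgA mulVg mul1g mulgKV.
by rewrite invgK !mulgA mulgV mul1g mulgK.
Qed.

Lemma dehn_op_distr x y z :
  dehn_op (dehn_op x y) z = dehn_op (dehn_op x z) (dehn_op y z).
Proof. by apply: val_inj; rewrite /= !invgM invgK !mulgA !mulgKV. Qed.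

HB.instance Definition _ := isQuandle.Build (dehn_quandle A)
  dehn_op_idem dehn_op_bij dehn_op_distr.

End DehnQuandle.

(* Main.v *)
From HB Require Import structures.
Require Import Defs.
From mathcomp Require Import all_boot all_fingroup.
From mathcomp Require Import boolp classical_sets.

(** Inside the wreath product H of G by the group of order 2, let s be the
    element swapping the two factors of the base group G x G.  Since
      (g, h) s (g, h)^-1 = (g h^-1, h g^-1) s,
    the conjugacy class of s consists exactly of the involutions
      i(x) = (x, x^-1) s,
    and x |-> i(x) is a bijection from G onto this class.  Multiplying out,
      i(y) i(x) i(y)^-1 = (y x^-1 y, (y x^-1 y)^-1) s = i(y x^-1 y),
    so i carries the core operation to conjugation.  The Dehn quandle of the
    single element s is therefore isomorphic to Core(G). *)

Local Open Scope classical_set_scope.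
Local Open Scope group_scope.

Definition swap_wreath (G : groupType) : Type := (G * G * bool)%type.

HB.instance Definition _ (G : groupType) :=
  Choice.copy (swap_wreath G) (G * G * bool)%type.

Section SwapWreath.
Variable G : groupType.
Implicit Types u v : swap_wreath G.

(** The boolean acts on the pair to its right by exchanging the components, as
    in a semidirect product with the group of order 2. *)
Definition wreath_mul u v : swap_wreath G :=
  let: (a, b, s) := u in let: (c, d, t) := v in
  if s then (a * d, b * c, ~~ t) else (a * c, b * d, t).

Definition wreath_one : swap_wreath G := (1, 1, false).

Definition wreath_inv u : swap_wreath G :=
  let: (a, b, s) := u in if s then (b^-1, a^-1, s) else (a^-1, b^-1, s).

Lemma wreath_mulA : associative wreath_mul.
Proof. by move=> [[a b] []] [[c d] []] [[e f] []] /=; rewrite ?mulgA. Qed.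

Lemma wreath_mul1g : left_id wreath_one wreath_mul.
Proof. by move=> [[a b] s] /=; rewrite !mul1g. Qed.

Lemma wreath_mulg1 : right_id wreath_one wreath_mul.
Proof. by move=> [[a b] []] /=; rewrite !mulg1. Qed.

Lemma wreath_mulVg : left_inverse wreath_one wreath_inv wreath_mul.
Proof. by move=> [[a b] []] /=; rewrite !mulVg. Qed.

Lemma wreath_mulgV : right_inverse wreath_one wreath_inv wreath_mul.
Proof. by move=> [[a b] []] /=; rewrite !mulgV. Qed.

HB.instance Definition _ := isGroup.Build (swap_wreath G)
  wreath_mulA wreath_mul1g wreath_mulg1 wreath_mulVg wreath_mulgV.

(** Unfolds the wreath product operations only, keeping those of G folded so
    that the group lemmas still apply to the components. *)
Lemma wreathE : (forall u v, u * v = wreath_mul u v) *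
  (forall u, u^-1 = wreath_inv u).
Proof. by []. Qed.

Definition swap : swap_wreath G := (1, 1, true).

Definition swap_class (x : G) : swap_wreath G := (x, x^-1, true).

(** Conjugating the swap s by (a, b) in the base group gives the parameter
    x = a^-1 b, and conjugating by (a, b) s gives the inverse of that.  The
    elements (1, x) of the base group already realise every x in G. *)
Lemma conj_closure_swap : conj_closure [set swap] = range swap_class.
Proof.
apply/seteqP; split=> [_ [_ -> [[[a b] s] ->]]|_ [x _ <-]].
  exists (if s then b^-1 * a else a^-1 * b) => //.
  rewrite conjgE !wreathE /swap_class; case: s => /=;
    by rewrite ?invgM ?invgK ?mul1g ?mulg1.
exists swap => //; exists (1, x, false).
by rewrite conjgE !wreathE /= invg1 !mul1g !mulg1.
Qed.

Lemma swap_class_core (x y : G) :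
  swap_class (core_op x y) = swap_class y * swap_class x * (swap_class y)^-1.
Proof. by rewrite !wreathE /swap_class /core_op /= !invgM !invgK !mulgA. Qed.

Lemma swap_class_mem (x : G) : swap_class x \in conj_closure [set swap].
Proof. by rewrite conj_closure_swap; apply: mem_set; exists x. Qed.

Definition core_to_dehn (x : core_quandle G) : dehn_quandle [set swap] :=
  exist _ (swap_class x) (swap_class_mem x).

Lemma core_to_dehn_bij : bijective core_to_dehn.
Proof.
exists (fun z : conj_closure [set swap] => (val z).1.1) => // -[u u_swap].
apply: val_inj => /=.
by move: u_swap; rewrite conj_closure_swap => /set_mem [x _ <-].
Qed.

Lemma core_to_dehn_morph : {morph core_to_dehn : x y / qop x y >-> qop x y}.
Proof. by move=> x y; apply: val_inj; exact: swap_class_core. Qed.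

End SwapWreath.

Theorem proposition3p11 (G : groupType) :
  exists (H : groupType) (A : set H),
    A !=set0 /\ quandle_isomorphic (core_quandle G) (dehn_quandle A).
Proof.
exists (swap_wreath G), [set swap G]; split; first by exists (swap G).
exists (@core_to_dehn G); split.
  exact: core_to_dehn_bij.
exact: core_to_dehn_morph.
Qed.
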